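(* Let $F$ be a two-dimensional real Banach space with a $1$-unconditional normalised basis, and let $X_1,X_2$ be Banach spaces. If the $F$-sum $X=(X_1\oplus X_2)_F$ has the Daugavet property, then either $F=\ell_1^2$ or $F=\ell_\infty^2$ (i.e. the norm of $F$ in coordinates is $|a_1|+|a_2|$ or $\max\{|a_1|,|a_2|\}$); in other words, either $X=X_1\oplus_1 X_2$ or $X=X_1\oplus_\infty X_2$.
   Context: All Banach spaces are real and $X_1,X_2$ are nonzero. A Banach space $X$ has the Daugavet property if $\|\mathrm{Id}+T\|=1+\|T\|$ for every bounded rank-$1$ linear operator $T: X\to X$. $F$ is identified with $\mathbb{R}^2$ via its basis, so that $\|(a_1,a_2)\|_F=\|(|a_1|,|a_2|)\|_F$ and $\|(1,0)\|_F=\|(0,1)\|_F=1$. The $F$-sum $(X_1\oplus X_2)_F$ is the space of pairs $(x_1,x_2)$, $x_j\in X_j$, with norm $\|(\|x_1\|,\|x_2\|)\|_F$. $\oplus_1$ and $\oplus_\infty$ are the sums with norms $\|x_1\|+\|x_2\|$ and $\max\{\|x_1\|,\|x_2\|\}$. *)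

(* Defs.v *)
From HB Require Import structures.
From mathcomp Require Import all_boot all_order all_algebra.
From mathcomp Require Import all_classical all_reals all_analysis.
From mathcomp Require Import ring lra.

Set Implicit Arguments.
Unset Strict Implicit.
Unset Printing Implicit Defensive.

Import Order.TTheory GRing.Theory Num.Theory.
Import numFieldNormedType.Exports.

Local Open Scope classical_set_scope.
Local Open Scope ring_scope.

(* Meaningful for bounded linear f: [sup] is 0 on unbounded sets. *)
Definition opnorm (R : realType) (V W : normedModType R) (f : V -> W) : R :=
  sup [set `|f x| | x in [set x | `|x| <= 1]].

Definition rank1 (R : realType) (V W : normedModType R) (f : V -> W) : Prop :=
  exists2 y : W, y != 0 & range f = range (fun a : R => a *: y).

Definition daugavet (R : realType) (X : completeNormedModType R) : Prop :=
  forall T : {linear X -> X}, bounded_near T (nbhs 0) -> rank1 T ->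
    opnorm (fun x => x + T x) = 1 + opnorm T.

(* The algebraic basis [ubasis_span] with two elements is what makes F
   two-dimensional. *)
Record ubasis2 (R : realType) (F : normedModType R) := UBasis2 {
  ubasis_e1 : F;
  ubasis_e2 : F;
  ubasis_span : forall v : F,
    exists! a : R * R, v = a.1 *: ubasis_e1 + a.2 *: ubasis_e2;
  ubasis_unconditional : forall a1 a2 : R,
    `|a1 *: ubasis_e1 + a2 *: ubasis_e2| =
    `| `|a1| *: ubasis_e1 + `|a2| *: ubasis_e2|;
  ubasis_normal1 : `|ubasis_e1| = 1;
  ubasis_normal2 : `|ubasis_e2| = 1 }.

Section coord_norm.
Context {R : realType} {F : normedModType R} (B : ubasis2 F).
Implicit Types a b c : R.

Definition coord_norm a b : R := `|a *: ubasis_e1 B + b *: ubasis_e2 B|.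

Let N := coord_norm.

Lemma coord_norm_abs a b : N a b = N `|a| `|b|.
Proof. exact: ubasis_unconditional. Qed.

Lemma coord_norm_ge0 a b : 0 <= N a b.
Proof. exact: normr_ge0. Qed.

Lemma coord_normD a b a' b' : N (a + a') (b + b') <= N a b + N a' b'.
Proof.
by rewrite /N /coord_norm !scalerDl addrACA; exact: ler_normD.
Qed.

Lemma coord_normZ c a b : N (c * a) (c * b) = `|c| * N a b.
Proof. by rewrite /N /coord_norm -normrZ scalerDr !scalerA. Qed.

Lemma coord_norm_e1 a : N a 0 = `|a|.
Proof.
by rewrite /N /coord_norm scale0r addr0 normrZ ubasis_normal1 mulr1.
Qed.

Lemma coord_norm_e2 b : N 0 b = `|b|.
Proof.
by rewrite /N /coord_norm scale0r add0r normrZ ubasis_normal2 mulr1.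
Qed.

Lemma coord_norm_mono1 a a' b : `|a| <= `|a'| -> N a b <= N a' b.
Proof.
move=> le_aa'; have [a'0|a'0] := eqVneq a' 0.
  by move: le_aa'; rewrite a'0 normr0 normr_le0 => /eqP ->.
pose t := (1 + a / a') / 2.
have le1 : `|a / a'| <= 1.
  by rewrite normrM normfV ler_pdivrMr ?normr_gt0 // mul1r.
have [le1l le1r] : -1 <= a / a' /\ a / a' <= 1.
  by apply/andP; rewrite -ler_norml.
have flip : N (- a') b = N a' b.
  by rewrite coord_norm_abs normrN -coord_norm_abs.
have -> : a = t * a' + (1 - t) * (- a') by rewrite /t; field.
have {1}-> : b = t * b + (1 - t) * b by ring.
apply: (le_trans (coord_normD _ _ _ _)).
rewrite !coord_normZ flip -mulrDl !ger0_norm; last 2 first.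
- by rewrite /t; lra.
- by rewrite /t; lra.
by rewrite addrC subrK mul1r.
Qed.

Lemma coord_norm_mono2 a b b' : `|b| <= `|b'| -> N a b <= N a b'.
Proof.
move=> le_bb'; have [b'0|b'0] := eqVneq b' 0.
  by move: le_bb'; rewrite b'0 normr0 normr_le0 => /eqP ->.
pose t := (1 + b / b') / 2.
have le1 : `|b / b'| <= 1.
  by rewrite normrM normfV ler_pdivrMr ?normr_gt0 // mul1r.
have [le1l le1r] : -1 <= b / b' /\ b / b' <= 1.
  by apply/andP; rewrite -ler_norml.
have flip : N a (- b') = N a b'.
  by rewrite coord_norm_abs normrN -coord_norm_abs.
have -> : b = t * b' + (1 - t) * (- b') by rewrite /t; field.
have {1}-> : a = t * a + (1 - t) * a by ring.
apply: (le_trans (coord_normD _ _ _ _)).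
rewrite !coord_normZ flip -mulrDl !ger0_norm; last 2 first.
- by rewrite /t; lra.
- by rewrite /t; lra.
by rewrite addrC subrK mul1r.
Qed.

Lemma coord_norm_ge1 a b : `|a| <= N a b.
Proof. by rewrite -coord_norm_e1 coord_norm_mono2 // normr0. Qed.

Lemma coord_norm_ge2 a b : `|b| <= N a b.
Proof. by rewrite -coord_norm_e2 coord_norm_mono1 // normr0. Qed.

Lemma coord_norm_le a b : N a b <= `|a| + `|b|.
Proof.
rewrite -coord_norm_e1 -coord_norm_e2.
by have := coord_normD a 0 0 b; rewrite addr0 add0r.
Qed.

End coord_norm.

(* An alias of the product, because [X1 * X2] itself carries the library's
   max norm. *)
Definition fsum (R : realType) (F : normedModType R) (B : ubasis2 F)
  (X1 X2 : normedModType R) : Type := (X1 * X2)%type.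

Section fsum_normed.
Context {R : realType} {F : normedModType R} (B : ubasis2 F).
Context (X1 X2 : normedModType R).

HB.instance Definition _ :=
  GRing.Lmodule.copy (fsum B X1 X2) (X1 * X2)%type.

Definition fsum_norm (x : fsum B X1 X2) : R := coord_norm B `|x.1| `|x.2|.

Let fsum_normD (x y : fsum B X1 X2) :
  fsum_norm (x + y) <= fsum_norm x + fsum_norm y.
Proof.
rewrite /fsum_norm.
apply: (le_trans _ (coord_normD _ _ _ _ _)).
apply: (@le_trans _ _ (coord_norm B (`|x.1| + `|y.1|) `|(x + y).2|)).
  apply: coord_norm_mono1; rewrite normr_id ger0_norm ?addr_ge0 //.
  exact: ler_normD.
apply: coord_norm_mono2; rewrite normr_id ger0_norm ?addr_ge0 //.
exact: ler_normD.
Qed.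

Let fsum_normZ (c : R) (x : fsum B X1 X2) :
  fsum_norm (c *: x) = `|c| * fsum_norm x.
Proof. by rewrite /fsum_norm !normrZ coord_normZ normr_id. Qed.

Let fsum_norm_eq0 (x : fsum B X1 X2) : fsum_norm x = 0 -> x = 0.
Proof.
move=> x0.
have := coord_norm_ge1 B `|x.1| `|x.2|.
have := coord_norm_ge2 B `|x.1| `|x.2|.
rewrite -/(fsum_norm x) x0 !normr_id !normr_le0 => /eqP h2 /eqP h1.
by rewrite (surjective_pairing x) h1 h2.
Qed.

HB.instance Definition _ :=
  Lmodule_isNormed.Build R (fsum B X1 X2) fsum_normD fsum_normZ fsum_norm_eq0.

Lemma fsum_normE (x : fsum B X1 X2) : `|x| = coord_norm B `|x.1| `|x.2|.
Proof. by []. Qed.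

Lemma fsum_norm_ge1 (x : fsum B X1 X2) : `|x.1| <= `|x|.
Proof. by rewrite fsum_normE -{1}[`|x.1|]normr_id coord_norm_ge1. Qed.

Lemma fsum_norm_ge2 (x : fsum B X1 X2) : `|x.2| <= `|x|.
Proof. by rewrite fsum_normE -{1}[`|x.2|]normr_id coord_norm_ge2. Qed.

Lemma fsum_norm_le (x : fsum B X1 X2) : `|x| <= `|x.1| + `|x.2|.
Proof. by rewrite fsum_normE (le_trans (coord_norm_le _ _ _)) // !normr_id. Qed.

End fsum_normed.

Section fsum_complete.
Context {R : realType} {F : normedModType R} (B : ubasis2 F).
Context (X1 X2 : completeNormedModType R).

Let fsum_cauchy_cvg (G : set_system (fsum B X1 X2)) :
  ProperFilter G -> cauchy G -> cvg G.
Proof.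
move=> PG cG.
have c1 : cvg (fst @ G : set_system X1).
  apply: cauchy_cvg; apply/cauchyP => e e0.
  have /cauchyP/(_ e e0)[x Gx] := cG.
  exists x.1; apply: (@filterS _ G _ (ball x e)) Gx => y.
  rewrite -!ball_normE /=; apply: le_lt_trans.
  exact: (fsum_norm_ge1 (x - y)).
have c2 : cvg (snd @ G : set_system X2).
  apply: cauchy_cvg; apply/cauchyP => e e0.
  have /cauchyP/(_ e e0)[x Gx] := cG.
  exists x.2; apply: (@filterS _ G _ (ball x e)) Gx => y.
  rewrite -!ball_normE /=; apply: le_lt_trans.
  exact: (fsum_norm_ge2 (x - y)).
apply/cvg_ex; exists ((lim (fst @ G), lim (snd @ G)) : fsum B X1 X2).
apply/cvgrPdist_lt => e e0.
have e20 : 0 < e / 2 by rewrite divr_gt0.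
move/cvgrPdist_lt : (c1) => /(_ _ e20) h1.
move/cvgrPdist_lt : (c2) => /(_ _ e20) h2.
near=> y.
rewrite (le_lt_trans (fsum_norm_le _)) // [e]splitr ltrD //=.
- by near: y; exact: h1.
- by near: y; exact: h2.
Unshelve. all: by end_near. Qed.

HB.instance Definition _ :=
  Uniform_isComplete.Build (fsum B X1 X2) fsum_cauchy_cvg.

End fsum_complete.

(* Main.v *)
Require Import Defs.
From HB Require Import structures.
From mathcomp Require Import all_boot all_order all_algebra.
From mathcomp Require Import all_classical all_reals all_analysis.
From mathcomp Require Import ring lra.

Set Implicit Arguments.
Unset Strict Implicit.
Unset Printing Implicit Defensive.

Import Order.TTheory GRing.Theory Num.Theory.
Import numFieldNormedType.Exports.

Local Open Scope classical_set_scope.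
Local Open Scope ring_scope.

(** Write N for the norm of F in coordinates.  In a space with the Daugavet
    property, for a unit vector x, a norm-one functional f that attains its
    norm and e > 0, some y in the unit ball has f y > 1 - e and
    |x + y| > 2 - e: apply the definition to z |-> f z *: x
    ([daugavet_slice]).  Take x = (x1, 0) and f = (0, f2) in the F-sum, where
    f2 is a norming functional of a vector of X2.  The norms of the components
    of y are then numbers u, v with N u v <= 1, v close to 1 and N (1 + u) v
    close to 2, so by compactness some c in [0, 1] has N c 1 = 1 and
    N (1 + c) 1 = 2.  Exchanging the two summands gives d in [0, 1] with
    N 1 d = 1 and N 1 (1 + d) = 2.

    The rest is plane geometry.  The midpoint ((1 + c) / 2, 1 / 2) of (1, 0) and
    (c, 1) is a unit vector, so the line through these two points supports the
    unit ball.  If c < 1 and d > 0, then the point (1, d) of the unit ball lies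
    strictly beyond that line, which is absurd.  Hence c = 1, so that
    N 1 1 = 1 and N is the maximum norm, or d = 0, so that N 1 1 = 2 and N is
    the sum norm ([coord_norm_max], [coord_norm_sum]).

    The norming functional comes from a form of the Hahn-Banach theorem: a
    minimal sublinear functional is linear ([sublinear_dominates_linear]). *)

(** * Sublinear functionals and norming functionals *)

Section sublinear.
Context {R : realType} {V : lmodType R}.
Implicit Types (p q : V -> R) (x y : V).

(** The inequality for positive scalars is equivalent to positive homogeneity
    ([sublinearZ]) and is easier to check for infima. *)
Definition sublinear p : Prop :=
  (forall x y, p (x + y) <= p x + p y) /\
  (forall t x, 0 < t -> p (t *: x) <= t * p x).

Lemma sublinear0 p : sublinear p -> p 0 = 0.
Proof.
move=> [_ pZ].
have h2 := pZ 2 0 ltac:(lra); have h12 := pZ 2^-1 0 ltac:(lra).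
by move: h2 h12; rewrite !scaler0; lra.
Qed.

Lemma sublinearZ p t x : sublinear p -> 0 <= t -> p (t *: x) = t * p x.
Proof.
move=> sp; rewrite le_eqVlt => /orP[/eqP <-|t0].
  by rewrite scale0r sublinear0 // mul0r.
have [_ pZ] := sp; apply/le_anti; rewrite pZ //=.
have := pZ t^-1 (t *: x); rewrite invr_gt0 scalerA mulVf ?gt_eqF // scale1r.
by move=> /(_ t0); rewrite ler_pdivlMl.
Qed.

Lemma sublinearN p x : sublinear p -> - p (- x) <= p x.
Proof.
move=> sp; have [pD _] := sp; have := pD x (- x).
by rewrite subrr sublinear0 //; lra.
Qed.

(** Common to the two infima taken below: over a chain of sublinear
    functionals, and along a ray. *)
Lemma sublinear_inf (P : V -> set R) :
  (forall x, P x !=set0) -> (forall x, has_lbound (P x)) ->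
  (forall x y a b, P x a -> P y b -> exists2 c, P (x + y) c & c <= a + b) ->
  (forall t x a, 0 < t -> P x a -> exists2 c, P (t *: x) c & c <= t * a) ->
  sublinear (fun x => inf (P x)).
Proof.
move=> P0 Pb PD PZ; have ge_inf' x c : P x c -> inf (P x) <= c by exact: ge_inf.
split=> [x y|t x t0].
  rewrite -lerBlDr; apply: lb_le_inf => // a Pa.
  rewrite lerBlDr -lerBlDl; apply: lb_le_inf => // b Pb'.
  rewrite lerBlDl; have [c Pc] := PD _ _ _ _ Pa Pb'.
  exact/le_trans/ge_inf'.
rewrite -ler_pdivrMl //; apply: lb_le_inf => // a Pa.
rewrite ler_pdivrMl //; have [c Pc] := PZ _ _ _ t0 Pa.
exact/le_trans/ge_inf'.
Qed.

(** The functional q x = inf over t >= 0 of p (x + t *: y) - t * p y lowers p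
    until it is linear along the direction y.  A minimal p equals q, which
    makes it additive; and the bound at - y gives q (- y) <= - p y. *)
Lemma sublinear_lower p y : sublinear p ->
  exists q, [/\ sublinear q, forall x, q x <= p x &
                forall x, q x <= p (x + y) - p y].
Proof.
move=> sp; have [pD pZ] := sp.
pose P x := [set p (x + t *: y) - t * p y | t in [set t | 0 <= t]].
have Pb x : has_lbound (P x).
  exists (- p (- x)) => _ [t /= t0 <-].
  have := pD (x + t *: y) (- x).
  by rewrite addrAC subrr add0r (sublinearZ _ sp t0); lra.
have ge_infP x t : 0 <= t -> inf (P x) <= p (x + t *: y) - t * p y.
  by move=> t0; apply: ge_inf => //; exists t.
exists (fun x => inf (P x)); split=> [|x|x].
- apply: sublinear_inf => // [x|x x' _ _ [t /= t0 <-] [t' /= t'0 <-]|].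
  + by exists (p (x + 0 *: y) - 0 * p y); exists 0 => /=.
  + exists (p (x + x' + (t + t') *: y) - (t + t') * p y).
      by exists (t + t') => //=; rewrite addr_ge0.
    have := pD (x + t *: y) (x' + t' *: y).
    by rewrite addrACA -scalerDl; lra.
  + move=> s x _ s0 [t /= t0 <-].
    exists (p (s *: x + (s * t) *: y) - (s * t) * p y).
      by exists (s * t) => //=; rewrite mulr_ge0 // ltW.
    have := pZ s (x + t *: y) s0; rewrite scalerDr scalerA; lra.
- by have := ge_infP x 0 (lexx _); rewrite scale0r addr0 mul0r subr0.
- by have := ge_infP x 1 ler01; rewrite scale1r mul1r.
Qed.

Lemma sublinear_minimal p0 : sublinear p0 ->
  exists p, [/\ sublinear p, forall x, p x <= p0 x &
    forall q, sublinear q -> (forall x, q x <= p x) -> forall x, p x <= q x].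
Proof.
move=> sp0.
pose T := {p : V -> R | sublinear p /\ forall x, p x <= p0 x}.
pose le (p q : T) := `[< forall x, sval q x <= sval p x >].
pose t0 : T := exist _ p0 (conj sp0 (fun x => lexx _)).
have [||A totA|p pmin] := @ZL_preorder T t0 le.
- by move=> p; apply/asboolP.
- move=> p q r /asboolP pq /asboolP qr; apply/asboolP => x.
  exact: le_trans (qr x) (pq x).
- have [[a Aa]|A0] := pselect (A !=set0); last first.
    by exists t0 => s As; case: A0; exists s.
  pose P x := [set sval p x | p in A].
  have Pb x : has_lbound (P x).
    exists (- p0 (- x)) => _ [p Ap <-]; have [sp le_p] := svalP p.
    by apply: (le_trans _ (sublinearN x sp)); rewrite lerN2.
  have ge_infP x (p : T) : A p -> inf (P x) <= sval p x.
    by move=> Ap; apply: ge_inf => //; exists p.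
  have sq : sublinear (fun x => inf (P x)).
    apply: sublinear_inf => // [x||t x _ t_gt0 [p Ap <-]].
    + by exists (sval a x); exists a.
    + move=> x y _ _ [p Ap <-] [q Aq <-].
      (* the smaller of the two functionals serves for both summands *)
      have [/asboolP le_qp|/asboolP le_pq] := totA p q Ap Aq.
      * exists (sval q (x + y)); first by exists q.
        by have [[qD _] _] := svalP q; rewrite (le_trans (qD _ _)) // lerD2r.
      * exists (sval p (x + y)); first by exists p.
        by have [[pD _] _] := svalP p; rewrite (le_trans (pD _ _)) // lerD2l.
    + exists (sval p (t *: x)); first by exists p.
      by have [[_ pZ] _] := svalP p; exact: pZ.
  have le_q x : inf (P x) <= p0 x.
    by have [_ /(_ x)] := svalP a; exact/le_trans/ge_infP.
  exists (exist _ (fun x => inf (P x)) (conj sq le_q)) => s As; apply/asboolP => x /=.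
  exact: ge_infP.
- have [sp le_p] := svalP p; exists (sval p); split=> // q sq le_qp.
  have le_q x : q x <= p0 x := le_trans (le_qp x) (le_p x).
  pose q' : T := exist _ q (conj sq le_q).
  suff /asboolP : le q' p by [].
  by apply: pmin; apply/asboolP.
Qed.

(** A minimal sublinear functional p is at most each q of [sublinear_lower],
    hence superadditive. *)
Lemma sublinear_dominates_linear p0 : sublinear p0 ->
  exists f : {scalar V}, forall x, f x <= p0 x.
Proof.
move=> /sublinear_minimal[p [sp le_p pmin]].
have [pD _] := sp.
have pE x y : p (x + y) = p x + p y.
  apply/le_anti; rewrite pD /=.
  have [q [sq le_qp q_y]] := sublinear_lower y sp.
  by rewrite -lerBrDr (le_trans (pmin q sq le_qp x) (q_y x)).
have pN x : p (- x) = - p x.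
  by apply/eqP; rewrite -addr_eq0 -pE addNr sublinear0.
have lin : scalar p.
  move=> a x y; rewrite pE; congr (_ + _).
  have [a0|/ltW a0] := leP 0 a; first exact: sublinearZ.
  by rewrite -[a]opprK scaleNr pN sublinearZ ?oppr_ge0 // !mulNr.
pose f : {scalar V} := HB.pack p (GRing.isLinear.Build R V R *%R p lin).
by exists f.
Qed.

End sublinear.

Lemma norming_functional {R : realType} {V : normedModType R} (x0 : V) :
  exists f : {scalar V}, (forall x, `|f x| <= `|x|) /\ f x0 = `|x0|.
Proof.
have sn : sublinear (fun x : V => `|x|).
  split=> [x y|t x t0]; first exact: ler_normD.
  by rewrite normrZ gtr0_norm.
(* below [q], the value at [- x0] is at most [- `|x0|] *)
have [q [sq le_q q_x0]] := sublinear_lower x0 sn.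
have [f le_f] := sublinear_dominates_linear sq.
have f_le x : f x <= `|x| := le_trans (le_f x) (le_q x).
exists f; split=> [x|].
  by rewrite ler_norml f_le andbT lerNl -raddfN -normrN f_le.
apply/le_anti; rewrite f_le /=.
have := le_trans (le_f (- x0)) (q_x0 (- x0)).
by rewrite addNr normr0 raddfN; lra.
Qed.

(** * The Daugavet property of a sum *)

(** Almost all of the norm 2 of [Id + f(.) *: x] is seen at some [z], where
    |f z| is then close to 1; replacing z by -z makes f z close to 1, so that
    z + f z *: x is close to z + x. *)
Lemma daugavet_slice {R : realType} {X : completeNormedModType R}
    (hD : daugavet X) (f : {scalar X}) (x z0 : X) (e : R) :
  (forall z, `|f z| <= `|z|) -> `|z0| = 1 -> f z0 = 1 -> `|x| = 1 -> 0 < e ->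
  exists y, [/\ `|y| <= 1, 1 - e < f y & 2 - e < `|x + y|].
Proof.
move=> f_le z01 fz0 x1 e0.
have lin : linear (fun z => f z *: x).
  by move=> a u v; rewrite linearP scalerDl scalerA.
pose T : {linear X -> X} :=
  HB.pack (fun z => f z *: x) (GRing.isLinear.Build R X X *:%R _ lin).
have normT z : `|T z| = `|f z| by rewrite /= normrZ x1 mulr1.
have T_bnd : bounded_near T (nbhs 0).
  by apply/linear_boundedP; near=> r => z; rewrite normT (le_trans (f_le z)) //
    ler_peMl //; near: r; exact: nbhs_pinfty_ge.
have T_rank1 : rank1 T.
  exists x; first by rewrite -normr_gt0 x1.
  apply/seteqP; split=> [_ [z _ <-]|_ [a _ <-]]; first by exists (f z).
  by exists (a *: z0) => //=; rewrite linearZ /= fz0 mulr1.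
have T_norm : opnorm T = 1.
  have ub1 : ubound [set `|T z| | z in [set z | `|z| <= 1]] 1.
    by move=> _ [z /= z1 <-]; rewrite normT (le_trans (f_le z)).
  have T_z0 : [set `|T z| | z in [set z | `|z| <= 1]] 1.
    by exists z0; rewrite /= ?z01 // normrZ fz0 x1 normr1 mulr1.
  apply/le_anti/andP; split; first by apply: ge_sup => //; exists 1.
  by apply: ub_le_sup => //; exists 1.
have := hD T T_bnd T_rank1; rewrite T_norm => sup2.
have [||_ [z /= z1 <-] zT] := @sup_gt _
    [set `|z + T z| | z in [set z | `|z| <= 1]] (2 - e / 2).
- by exists `|z0 + T z0|; exists z0; rewrite /= ?z01.
- by move: sup2; rewrite /opnorm => ->; lra.
suff wlog_ge0 y : `|y| <= 1 -> 0 <= f y -> 2 - e / 2 < `|y + f y *: x| ->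
    exists y, [/\ `|y| <= 1, 1 - e < f y & 2 - e < `|x + y|].
  have [fz|/ltW fz] := leP 0 (f z); first exact: (wlog_ge0 z).
  apply: (wlog_ge0 (- z)); rewrite ?normrN // raddfN ?oppr_ge0 //.
  by rewrite scaleNr -opprD normrN.
move=> y1 fy0 hy.
have fy1 : f y <= 1 by rewrite (le_trans (ler_norm _)) // (le_trans (f_le y)).
have h1 := ler_normD y (f y *: x).
rewrite normrZ x1 mulr1 ger0_norm // in h1.
have h2 := ler_normB (x + y) ((1 - f y) *: x).
have xyE : x + y - (1 - f y) *: x = y + f y *: x.
  by rewrite scalerBl scale1r opprB -addrA addrCA subrKC.
rewrite xyE normrZ x1 mulr1 ger0_norm ?subr_ge0 // in h2.
by exists y; split=> //; lra.
Unshelve. all: by end_near. Qed.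

Lemma exists_unit {R : realType} {V : normedModType R} :
  (exists x : V, x != 0) -> exists x : V, `|x| = 1.
Proof.
move=> [x x0]; exists (`|x|^-1 *: x).
by rewrite normrZ normfV normr_id mulVf // normr_eq0.
Qed.

Section daugavet_sum.
Context {R : realType} {F : normedModType R} (B : ubasis2 F).
Context (X1 X2 : completeNormedModType R).
Context (hX1 : exists x1 : X1, x1 != 0) (hX2 : exists x2 : X2, x2 != 0).
Context (hD : daugavet (fsum B X1 X2)).
Let N := coord_norm B.

(** The vector x lives in one summand and the functional f in the other, so
    that f y close to 1 pushes the norm of the second component of y to 1,
    while the norm of the first component remains free. *)
Lemma fsum_slice1 e : 0 < e -> exists u v,
  [/\ 0 <= u <= 1, 1 - e < v <= 1, N u v <= 1 & 2 - e < N (1 + u) v].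
Proof.
move=> e0; have [x1 x1E] := exists_unit hX1; have [x2 x2E] := exists_unit hX2.
have [g [g_le gE]] := norming_functional x2.
have lin : scalar (fun z : fsum B X1 X2 => g z.2).
  by move=> a u v; rewrite linearP.
pose f : {scalar fsum B X1 X2} := HB.pack (fun z : fsum B X1 X2 => g z.2)
  (GRing.isLinear.Build R (fsum B X1 X2) R *%R _ lin).
have [||||//|y [y1 fy xy]] :=
    @daugavet_slice _ _ hD f (x1, 0) (0, x2) e.
- by move=> z; rewrite (le_trans (g_le _)) // fsum_norm_ge2.
- by rewrite fsum_normE normr0 coord_norm_e2 normr_id.
- by rewrite /= gE.
- by rewrite fsum_normE normr0 coord_norm_e1 normr_id.
exists `|y.1|, `|y.2|; split=> //.
- by rewrite normr_ge0 (le_trans (fsum_norm_ge1 y)).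
- rewrite (le_trans (fsum_norm_ge2 y)) // andbT (lt_le_trans fy) //.
  exact: le_trans (ler_norm _) (g_le _).
- rewrite (lt_le_trans xy) // fsum_normE /= add0r coord_norm_mono1 //.
  by rewrite normr_id ger0_norm ?addr_ge0 // -x1E ler_normD.
Qed.

Lemma fsum_slice2 e : 0 < e -> exists u v,
  [/\ 0 <= u <= 1, 1 - e < v <= 1, N v u <= 1 & 2 - e < N v (1 + u)].
Proof.
move=> e0; have [x1 x1E] := exists_unit hX1; have [x2 x2E] := exists_unit hX2.
have [g [g_le gE]] := norming_functional x1.
have lin : scalar (fun z : fsum B X1 X2 => g z.1).
  by move=> a u v; rewrite linearP.
pose f : {scalar fsum B X1 X2} := HB.pack (fun z : fsum B X1 X2 => g z.1)
  (GRing.isLinear.Build R (fsum B X1 X2) R *%R _ lin).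
have [||||//|y [y1 fy xy]] :=
    @daugavet_slice _ _ hD f (0, x2) (x1, 0) e.
- by move=> z; rewrite (le_trans (g_le _)) // fsum_norm_ge1.
- by rewrite fsum_normE normr0 coord_norm_e1 normr_id.
- by rewrite /= gE.
- by rewrite fsum_normE normr0 coord_norm_e2 normr_id.
exists `|y.2|, `|y.1|; split=> //.
- by rewrite normr_ge0 (le_trans (fsum_norm_ge2 y)).
- rewrite (le_trans (fsum_norm_ge1 y)) // andbT (lt_le_trans fy) //.
  exact: le_trans (ler_norm _) (g_le _).
- rewrite (lt_le_trans xy) // fsum_normE /= add0r coord_norm_mono2 //.
  by rewrite normr_id ger0_norm ?addr_ge0 // -x2E ler_normD.
Qed.

End daugavet_sum.

(** * Plane geometry *)

(** The limit of the points (u, v) as e tends to 0.  The single inequality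
    suffices for a norm: M (1 + c) 1 <= 1 + M c 1 and 1 <= M c 1 then force
    M c 1 = 1 and M (1 + c) 1 = 2.  For M one takes the coordinate norm and
    its transpose. *)
Lemma slice_limit {R : realType} (M : R -> R -> R) :
  (forall a b a' b', M a b <= M a' b' + `|a - a'| + `|b - b'|) ->
  (forall e, 0 < e -> exists u v,
    [/\ 0 <= u <= 1, 1 - e < v <= 1, M u v <= 1 & 2 - e < M (1 + u) v]) ->
  exists2 c, 0 <= c <= 1 & 2 * M c 1 <= M (1 + c) 1.
Proof.
move=> Mlip Mslice; pose h c := 2 * M c 1 - M (1 + c) 1.
have cM b s : continuous (fun c => M (s + c) b).
  move=> c; apply/cvgrPdist_lt => e e0; near=> c'.
  have cc' : `|c - c'| < e by near: c'; exact: cvgr_dist_lt.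
  have := Mlip (s + c) b (s + c') b; have := Mlip (s + c') b (s + c) b.
  rewrite subrr normr0 addr0 [in `|s + c' - _|]distrC.
  have -> : s + c - (s + c') = c - c' by ring.
  by move=> h1 h2; rewrite ltr_norml; apply/andP; split; lra.
have ch : continuous h.
  have cM0 : continuous (M^~ 1).
    suff -> : M^~ 1 = (fun c => M (0 + c) 1) by exact: cM.
    by apply/funext => c; rewrite add0r.
  move=> c; apply: cvgB; last exact: cM.
  by apply: cvgM; [exact: cvg_cst|exact: cM0].
have [c c01 hmin] := @EVT_min R h 0 1 ler01 (continuous_subspaceT ch).
exists c; first by move: c01; rewrite in_itv.
rewrite -subr_le0; apply/ler_addgt0Pl => e e0.
have [u [v [u01 /andP[v_gt v_le] Muv M1uv]]] := Mslice (e / 4) ltac:(lra).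
have := hmin u; rewrite in_itv /= => /(_ u01); rewrite /h.
have := Mlip u 1 u v; have := Mlip (1 + u) v (1 + u) 1.
rewrite !subrr !normr0 !addr0 distrC ger0_norm ?subr_ge0 //; lra.
Unshelve. all: by end_near. Qed.

Section plane.
Context {R : realType} {F : normedModType R} (B : ubasis2 F).
Let N := coord_norm B.

Lemma coord_norm_lipschitz a b a' b' :
  N a b <= N a' b' + `|a - a'| + `|b - b'|.
Proof.
have := coord_normD B a' b' (a - a') (b - b').
rewrite !subrKC => h; have := coord_norm_le B (a - a') (b - b').
by rewrite -/N in h *; lra.
Qed.

Lemma coord_norm_max a b : N 1 1 <= 1 -> N a b = Num.max `|a| `|b|.
Proof.
move=> N11; apply/le_anti/andP; split; last first.
  by rewrite ge_max coord_norm_ge1 coord_norm_ge2.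
set m := Num.max _ _.
have m0 : 0 <= m by rewrite le_max normr_ge0.
have ha : `|a| <= `|m| by rewrite (ger0_norm m0) le_max lexx.
have hb : `|b| <= `|m| by rewrite (ger0_norm m0) le_max lexx orbT.
apply: le_trans (coord_norm_mono1 B b ha) _.
apply: le_trans (coord_norm_mono2 B m hb) _.
have := coord_normZ B m 1 1; rewrite mulr1 ger0_norm // => ->.
by rewrite ler_piMr.
Qed.

(** For |b| <= |a| compare with (|a|, |a|), which has norm 2 |a| and differs
    from (|a|, |b|) by a vector of norm |a| - |b|. *)
Lemma coord_norm_sum a b : 2 <= N 1 1 -> N a b = `|a| + `|b|.
Proof.
move=> N11; apply/le_anti; rewrite coord_norm_le /=.
rewrite /N coord_norm_abs -/N; move: (normr_ge0 a) (normr_ge0 b).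
move: `|a| `|b| => {}a {}b a0 b0.
have Nd c : 0 <= c -> 2 * c <= N c c.
  move=> c0; have := coord_normZ B c 1 1; rewrite mulr1 ger0_norm // => Ncc.
  by rewrite /N Ncc mulrC ler_wpM2l.
have [ba|/ltW ab] := leP b a.
  have := coord_normD B a b 0 (a - b); have := Nd a a0.
  by rewrite addr0 subrKC coord_norm_e2 ger0_norm ?subr_ge0 // /N; lra.
have := coord_normD B a b (b - a) 0; have := Nd b b0.
by rewrite addr0 subrKC coord_norm_e1 ger0_norm ?subr_ge0 // /N; lra.
Qed.

(** The hypotheses say that the segments from (1, 0) to (c, 1) and from (0, 1)
    to (1, d) lie on the unit sphere.  For c < 1 and d > 0 the point (1 + c, 1),
    of norm 2, would be either dominated by (1 + c) times the unit vector
    (1, d), or a nonnegative combination of the unit vectors (c, 1) and (1, d)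
    with a sum of coefficients smaller than 2. *)
Lemma coord_norm_flat c d : 0 <= c <= 1 -> 0 <= d <= 1 ->
  2 * N c 1 <= N (1 + c) 1 -> 2 * N 1 d <= N 1 (1 + d) ->
  N 1 1 <= 1 \/ 2 <= N 1 1.
Proof.
move=> /andP[c0 c1] /andP[d0 d1] hc hd.
have Nc : N c 1 <= 1.
  have := coord_normD B 1 0 c 1; rewrite add0r coord_norm_e1 normr1 -/N; lra.
have Nd : N 1 d <= 1.
  have := coord_normD B 0 1 1 d; rewrite add0r coord_norm_e2 normr1 -/N; lra.
have Nc1 : 2 <= N (1 + c) 1.
  by have := coord_norm_ge2 B c 1; rewrite normr1 -/N; lra.
have [c_ge1|c_lt1] := leP 1 c.
  by left; move: Nc; have -> : c = 1 by lra.
suff d_eq0 : d = 0.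
  right; have := coord_norm_ge1 B 1 d; rewrite normr1 -/N.
  by move: hd; rewrite d_eq0 addr0; lra.
have [dc|dc] := leP 1 ((1 + c) * d).
  (* (1, d) lies above the ray through (1 + c, 1) *)
  have : N (1 + c) 1 <= N ((1 + c) * 1) ((1 + c) * d).
    rewrite mulr1; apply: coord_norm_mono2.
    by rewrite normr1 (le_trans dc) // ler_norm.
  rewrite /N coord_normZ -/N ger0_norm; last lra.
  by have : (1 + c) * N 1 d <= (1 + c) * 1 by [rewrite ler_wpM2l //; lra]; lra.
(* otherwise (1 + c, 1) is a nonnegative combination of (1, d) and (c, 1) *)
have comb := coord_normD B 1 d ((1 - d - c * d) * c) ((1 - d - c * d) * 1).
have E1 : 1 + (1 - d - c * d) * c = (1 - c * d) * (1 + c) by ring.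
have E2 : d + (1 - d - c * d) * 1 = (1 - c * d) * 1 by ring.
rewrite E1 E2 !coord_normZ -/N in comb.
have cd : c * d <= c by rewrite ler_piMr.
rewrite !ger0_norm in comb; [|lra|lra].
have l1 : (1 - c * d) * 2 <= (1 - c * d) * N (1 + c) 1.
  by rewrite ler_wpM2l //; lra.
have l2 : (1 - d - c * d) * N c 1 <= (1 - d - c * d) * 1.
  by rewrite ler_wpM2l //; lra.
have : (1 - c) * d <= 0 by lra.
rewrite pmulr_rle0; last lra.
by lra.
Qed.

End plane.

Theorem corollary5p4 (R : realType) (F : completeNormedModType R)
    (B : ubasis2 F) (X1 X2 : completeNormedModType R)
    (hX1 : exists x1 : X1, x1 != 0) (hX2 : exists x2 : X2, x2 != 0)
    (hD : daugavet (fsum B X1 X2)) :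
  ((forall a1 a2 : R,
      `|a1 *: ubasis_e1 B + a2 *: ubasis_e2 B| = `|a1| + `|a2|) /\
   (forall x : fsum B X1 X2, `|x| = `|x.1| + `|x.2|)) \/
  ((forall a1 a2 : R,
      `|a1 *: ubasis_e1 B + a2 *: ubasis_e2 B| = Num.max `|a1| `|a2|) /\
   (forall x : fsum B X1 X2, `|x| = Num.max `|x.1| `|x.2|)).
Proof.
have lip := coord_norm_lipschitz B.
have [c c01 hc] := slice_limit lip (fsum_slice1 hX1 hX2 hD).
have [|d d01 hd] := slice_limit (M := fun a b => coord_norm B b a) _
    (fsum_slice2 hX1 hX2 hD).
  by move=> a b a' b'; rewrite -addrA [`|a - a'| + _]addrC addrA lip.
have [N11|N11] := coord_norm_flat c01 d01 hc hd.
  right; split=> [a1 a2|x]; first exact: coord_norm_max.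
  by rewrite fsum_normE coord_norm_max // !normr_id.
left; split=> [a1 a2|x]; first exact: coord_norm_sum.
by rewrite fsum_normE coord_norm_sum // !normr_id.
Qed.
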